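(* Let $\Theta\subseteq\mathbb R$ be an open interval containing $0$ and let $(F_\theta)_{\theta\in\Theta}$ be a family of continuous joint cdf's on $\mathbb R^2$ with common marginal cdf's $G$ and $H$ not depending on $\theta$, such that $F_0(x,y)=G(x)H(y)$ for all real $x,y$. Let $\Theta_0\subseteq\Theta$ be a neighborhood of $0$. If $\frac{\partial}{\partial\theta}F_\theta(x,y)$ and $\frac{\partial^2}{\partial\theta^2}F_\theta(x,y)$ (exist and) are uniformly bounded over $\theta\in\Theta_0$ and $(x,y)\in\mathbb R^2$, then $$\frac1\theta\int_{\mathbb R^2}(F_\theta-F_0)\,d(F_\theta-F_0)\to0\quad\text{as }\theta\to0.$$ So, $\mathsf{ARE}_{T,S}(0)=1$ if, in addition, $$\liminf_{\theta\to0}\Big|\frac1\theta\int_{\mathbb R^2}(F_\theta-F_0)\,dF_0\Big|>0.$$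
   Context: Integrals against $dF_0$ and $d(F_\theta-F_0)$ are with respect to the probability measure with cdf $F_0$ and the signed measure which is the difference of the probability measures with cdf's $F_\theta$ and $F_0$. A neighborhood of $0$ here may be taken to be an open interval containing $0$. $\mathsf{ARE}_{T,S}(0)$ is the (two-sided Pitman) asymptotic relative efficiency, at the independence value $\theta=0$, of Kendall's correlation statistic $T$ relative to Spearman's correlation statistic $S$. With $(X,Y)$ having cdf $F_\theta$ under $\mathsf P_\theta$ (expectation $\mathsf E_\theta$, variance $\mathsf{Var}_\theta$), it is defined by $$\mathsf{ARE}_{T,S}(0):=\frac{\sigma_S^2(0)}{\sigma_T^2(0)}\lim_{\theta\to0}\frac{(\mu_T(\theta)-\mu_T(0))^2}{(\mu_S(\theta)-\mu_S(0))^2},$$ where $\mu_T(\theta)=4\,\mathsf E_\theta F_\theta(X,Y)-1$, $\mu_S(\theta)=12\,\mathsf E_\theta G(X)H(Y)-3$, $\sigma_T^2(\theta)=16\,\mathsf{Var}_\theta\big(2F_\theta(X,Y)-G(X)-H(Y)\big)$, and $$\sigma_S^2(\theta)=144\,\mathsf{Var}_\theta\Big((1-G(X))(1-H(Y))+\int_{\mathbb R}F_\theta(X,y)\,dH(y)+\int_{\mathbb R}F_\theta(x,Y)\,dG(x)\Big).$$ The assertion $\mathsf{ARE}_{T,S}(0)=1$ includes existence of the limit. *)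

(* Defs.v *)
From HB Require Import structures.
From mathcomp Require Import all_boot all_order all_algebra.
From mathcomp Require Import all_classical all_reals all_analysis.

Set Implicit Arguments.
Unset Strict Implicit.
Unset Printing Implicit Defensive.

Import Order.TTheory GRing.Theory Num.Theory.
Import numFieldNormedType.Exports.

Local Open Scope classical_set_scope.
Local Open Scope ring_scope.

Definition joint_cdf (R : realType) (P : probability (R * R)%type R)
    (x y : R) : R :=
  fine (P (`]-oo, x] `*` `]-oo, y])).

Definition has_marginal_cdfs (R : realType) (P : probability (R * R)%type R)
    (G H : R -> R) : Prop :=
  (forall x, P (`]-oo, x] `*` [set: R]) = (G x)%:E) /\
  (forall y, P ([set: R] `*` `]-oo, y]) = (H y)%:E).

(* Integral against a signed measure, through the positive and negative parts
   of its Jordan decomposition; the choice of the Hahn sets is immaterial. *)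
Definition charge_integral (d : measure_display) (T : measurableType d)
    (R : realType) (nu : {charge set T -> \bar R}) (f : T -> R) : R :=
  let P := cid (Hahn_decomposition nu) in
  let N := cid (svalP P) in
  Rintegral (jordan_pos (svalP N)) [set: T] f -
  Rintegral (jordan_neg (svalP N)) [set: T] f.

Definition probability_diff (d : measure_display) (T : measurableType d)
    (R : realType) (P Q : probability T R) : {charge set T -> \bar R} :=
  cadd (charge_of_finite_measure P) (copp (charge_of_finite_measure Q)).

Section asymptotic_relative_efficiency.
Variables (R : realType) (P : R -> probability (R * R)%type R).
Variables G H : cumulativeBounded (0 : R) (1 : R).

Let F theta := joint_cdf (P theta).
Let dG := lebesgue_stieltjes_measure G.
Let dH := lebesgue_stieltjes_measure H.

Definition mu_T (theta : R) : R :=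
  4 * fine 'E_(P theta)[fun z => F theta z.1 z.2] - 1.

Definition mu_S (theta : R) : R :=
  12 * fine 'E_(P theta)[fun z => G z.1 * H z.2] - 3.

Definition sigma2_T (theta : R) : R :=
  16 * fine 'V_(P theta)[fun z => 2 * F theta z.1 z.2 - G z.1 - H z.2].

Definition sigma2_S (theta : R) : R :=
  144 * fine 'V_(P theta)[fun z => (1 - G z.1) * (1 - H z.2)
    + Rintegral dH [set: R] (fun y => F theta z.1 y)
    + Rintegral dG [set: R] (fun x => F theta x z.2)].

Definition mean_shift_ratio (theta : R) : R :=
  (mu_T theta - mu_T 0) ^+ 2 / (mu_S theta - mu_S 0) ^+ 2.

(* Meaningful only when [mean_shift_ratio] converges at 0.  As x / 0 = 0, a
   nonzero value forces sigma2_T 0 <> 0 and a nonzero limit of the ratio, hence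
   mu_S theta <> mu_S 0 for all theta <> 0 near 0. *)
Definition ARE_TS : R :=
  sigma2_S 0 / sigma2_T 0 * lim (mean_shift_ratio theta @[theta --> 0^']).

End asymptotic_relative_efficiency.

(* Main.v *)
(* Write [E a b] for the integral of [F_a] against [P_b].  Fubini's theorem and
   the common continuous marginals make [E] symmetric, so the integral of
   [F_t - F_0] against [P_t - P_0] is a second-order difference of [E].  The
   bounds on the two derivatives control difference quotients of [F] in the
   parameter uniformly in [(x, y)]; combined with the symmetry they show that
   this second-order difference is o(t), with no weak convergence needed.
   Next, [mu_T t - mu_T 0 = 4 (o(t) + 2 A)] and [mu_S t - mu_S 0 = 12 A] with
   [A] the integral of [F_t - F_0] against [P_0], so the squared ratio tends to
   4/9 when [A] is at least of order [t].  At independence the statistic defining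
   [sigma2_S] is an affine function of the one defining [sigma2_T], and
   [sigma2_S 0 / sigma2_T 0 = 9/4]. *)
Require Import Defs.
From HB Require Import structures.
From mathcomp Require Import all_boot all_order all_algebra.
From mathcomp Require Import all_classical all_reals all_analysis.
From mathcomp Require Import measurable_realfun ring lra.

Set Implicit Arguments.
Unset Strict Implicit.
Unset Printing Implicit Defensive.

Import Order.TTheory GRing.Theory Num.Theory.
Import numFieldNormedType.Exports.

Local Open Scope classical_set_scope.
Local Open Scope ring_scope.

(** * Integrals of bounded functions against probability and signed measures *)

Section bounded_functions.
Context {d : measure_display} {T : measurableType d} {R : realType}.
Implicit Types f : T -> R.

Lemma bounded_measurable_integrable (mu : {measure set T -> \bar R})
    f (K : R) :
  (mu setT < +oo)%E ->
  measurable_fun setT f -> (forall t, `|f t| <= K) ->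
  mu.-integrable setT (EFin \o f).
Proof.
move=> muT mf fK; apply: measurable_bounded_integrable => //.
exists K; split; first exact: num_real.
by move=> M KM t _ /=; exact: le_trans (fK t) (ltW KM).
Qed.

(** Total mass one leaves the constant unchanged. This carries bounds that are pointwise in [(x, y)]
    over to integrals against any [P b]. *)
Lemma normr_Rintegral_le (P : probability T R) f (K : R) :
  measurable_fun setT f -> (forall t, `|f t| <= K) ->
  `|Rintegral P setT f| <= K.
Proof.
move=> mf fK.
have PT : (P setT < +oo)%E by rewrite probability_setT ltry.
have intf := bounded_measurable_integrable PT mf fK.
apply: (le_trans (le_normr_Rintegral measurableT intf)).
have -> : K = Rintegral P setT (cst K).
  by have /= := Rintegral_cst P measurableT K; rewrite probability_setT mulr1 => ->.
apply: le_Rintegral => //.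
- apply: (bounded_measurable_integrable PT (K := K)).
    exact: measurableT_comp.
  by move=> t; rewrite normr_id.
- by apply: (bounded_measurable_integrable PT (K := `|K|)).
Qed.

Lemma bounded_measurable_Lfun2 (P : probability T R) f (K : R) :
  measurable_fun setT f -> (forall t, `|f t| <= K) -> f \in Lfun P 2%:E.
Proof.
move=> mf fK; rewrite inE; apply/andP; split; rewrite inE//=.
rewrite /finite_norm unlock /Lnorm poweR_lty//.
have K0 : 0 <= K := le_trans (normr_ge0 _) (fK point).
apply: (@le_lt_trans _ _ (\int[P]_x (K `^ 2)%:E)%E).
  apply: ge0_le_integral => //.
  - by move=> x _; rewrite poweR_ge0.
  - apply/measurable_EFinP/(@measurableT_comp _ _ _ _ _ _ (@powR R ^~ 2)) => //.
    exact: measurableT_comp.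
  - by move=> x _ /=; rewrite lee_fin ge0_ler_powR ?nnegrE.
rewrite integral_cst// lte_mul_pinfty ?lee_fin ?powR_ge0//.
by rewrite [ltLHS]probability_setT ltry.
Qed.

(* For bounded integrands the Jordan decomposition of [P - Q] can be traded
   for [P] and [Q]: both [P + neg] and [Q + pos] are the same measure. *)
Lemma charge_integral_probability_diff (P Q : probability T R) f (K : R) :
  measurable_fun setT f -> (forall t, `|f t| <= K) ->
  charge_integral (probability_diff P Q) f =
  Rintegral P setT f - Rintegral Q setT f.
Proof.
move=> mf fK; rewrite /charge_integral /=.
set A := cid _; set B := cid _.
set hd := svalP B.
have mfE : measurable_fun setT (EFin \o f) by exact/measurable_EFinP.
have int (mu : {finite_measure set T -> \bar R}) :
    mu.-integrable setT (EFin \o f).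
  apply: (bounded_measurable_integrable _ mf fK).
  by rewrite ltey_eq fin_num_measure.
have E : (\int[measure_add P (jordan_neg hd)]_x (f x)%:E =
          \int[measure_add Q (jordan_pos hd)]_x (f x)%:E)%E.
  apply: eq_measure_integral => X mX _.
  have H : (P X - Q X = jordan_pos hd X - jordan_neg hd X)%E.
    by have := jordan_decomp hd mX; rewrite /cadd /= cscaleN1.
  transitivity (P X + jordan_neg hd X)%E; first exact: measure_addE.
  transitivity (Q X + jordan_pos hd X)%E; last exact/esym/measure_addE.
  move: H.
  have /fineK <- : P X \is a fin_num by rewrite fin_num_measure.
  have /fineK <- : Q X \is a fin_num by rewrite fin_num_measure.
  have /fineK <- : jordan_pos hd X \is a fin_num by rewrite fin_num_measure.
  have /fineK <- : jordan_neg hd X \is a fin_num by rewrite fin_num_measure.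
  rewrite -!EFinN -!EFinD => -[] H; congr (_%:E); lra.
rewrite !integral_measure_add// in E; try exact: int.
move: E; rewrite /Rintegral.
have fi (mu : {finite_measure set T -> \bar R}) :
  (\int[mu]_x (f x)%:E)%E \is a fin_num 
    by exact: (integrable_fin_num measurableT (int mu)).
rewrite -(fineK (fi P)) -(fineK (fi Q)).
rewrite -(fineK (fi (jordan_pos hd))) -(fineK (fi (jordan_neg hd))).
rewrite -!EFinD => -[] /= H; lra.
Qed.

End bounded_functions.

(** Tonelli's theorem for the indicator of [A]: the two sides are its iterated integrals in the two
    orders. *)
Lemma integral_sections (d1 d2 : measure_display) (T1 : measurableType d1)
    (T2 : measurableType d2) (R : realType)
    (m1 : {sigma_finite_measure set T1 -> \bar R})
    (m2 : {sigma_finite_measure set T2 -> \bar R}) (A : set (T1 * T2)) :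
  measurable A ->
  (\int[m1]_x m2 (xsection A x) = \int[m2]_y m1 (ysection A y))%E.
Proof.
move=> mA; have := indic_fubini_tonelli m1 m2 mA.
by rewrite indic_fubini_tonelli_FE// indic_fubini_tonelli_GE.
Qed.

(** * Random variables with a continuous cdf *)

Section continuous_cdf.
Context {d : measure_display} {T : measurableType d} {R : realType}.
Variables (mu : probability T R) (X : T -> R) (G : R -> R).
Hypothesis mX : measurable_fun setT X.
Hypothesis cdfG : forall x, mu [set t | X t <= x] = (G x)%:E.
Hypothesis contG : continuous G.

Let mle x : measurable [set t | X t <= x].
Proof.
have := measurable_fun_le measurableT mX (@measurable_cst _ _ _ _ setT x).
by rewrite setTI.
Qed.

Let mge x : measurable [set t | x <= X t].
Proof.
have := measurable_fun_le measurableT (@measurable_cst _ _ _ _ setT x) mX.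
by rewrite setTI.
Qed.

Let eqE x : [set t | X t = x] = [set t | X t <= x] `&` [set t | x <= X t].
Proof.
apply/seteqP; split => t /=; first by move=> ->; rewrite lexx.
by case=> a b; apply/eqP; rewrite eq_le a b.
Qed.

Lemma measurable_atom x : measurable [set t | X t = x].
Proof. by rewrite eqE; exact: measurableI. Qed.

(** The atom lies in the event that [X] falls in the half-open interval from [x - r / 2] to [x]. Its
    mass is an increment of [G], which continuity makes arbitrarily small. *)
Lemma continuous_cdf_atomless x : mu [set t | X t = x] = 0%E.
Proof.
apply/eqP; rewrite eq_le measure_ge0 andbT.
apply/lee_addgt0Pr => e e0; rewrite add0e.
have /cvgrPdist_le /(_ e e0) /nbhs_ballP [r /= r0 /(_ (x - r / 2))] := contG (x := x).
rewrite /ball /= opprB addrCA subrr addr0 gtr0_norm ?divr_gt0// => h.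
have {}h : `|G x - G (x - r / 2)| <= e by apply: h; lra.
have sub : [set t | X t <= x - r / 2] `<=` [set t | X t <= x].
  by move=> t /= /le_trans; apply; lra.
apply: (@le_trans _ _ (mu ([set t | X t <= x] `\` [set t | X t <= x - r / 2]))).
  apply: le_measure; rewrite ?inE//.
  - exact: measurable_atom.
  - exact: measurableD.
  - by move=> t /= ->; split; [exact: lexx|apply/negP; rewrite -ltNge; lra].
have -> : mu ([set t | X t <= x] `\` [set t | X t <= x - r / 2]) =
    (mu [set t | (X t <= x)%R] -
     mu ([set t | (X t <= x)%R] `&` [set t | (X t <= x - r / 2)%R]))%E.
  by apply: measureD => //; rewrite [ltLHS]cdfG ltry.
rewrite (setIidr sub) !cdfG -EFinB lee_fin.
exact: le_trans (ler_norm _) h.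
Qed.

Lemma continuous_cdf_ge x : mu [set t | x <= X t] = (1 - G x)%:E.
Proof.
have -> : [set t | x <= X t] = ~` [set t | X t <= x] `|` [set t | X t = x].
  apply/seteqP; split => t /=.
    rewrite le_eqVlt => /orP[/eqP|]; first by right.
    by rewrite ltNge => /negP; left.
  by case=> [/negP|->//]; rewrite -ltNge => /ltW.
transitivity (mu (~` [set t | X t <= x])); last first.
  by rewrite probability_setC// cdfG.
apply: measureU0; last exact: continuous_cdf_atomless.
- exact: measurableC.
- exact: measurable_atom.
Qed.

Lemma measurable_cdf : measurable_fun setT G.
Proof.
apply: nondecreasing_measurable => // x y xy.
rewrite -lee_fin -!cdfG; apply: le_measure; rewrite ?inE//.
by move=> t /= /le_trans; apply.
Qed.

Lemma cdf_norm_le1 x : `|G x| <= 1.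
Proof.
by rewrite ger0_norm -lee_fin -cdfG; [exact: probability_le1|exact: measure_ge0].
Qed.

(** Take two independent copies of [X] and the event that the second is at most the first. Its
    sections have mass [G (X t)] one way and, for want of atoms, [1 - G (X t)] the other way, so the
    integral [m] satisfies [m = 1 - m]. *)
Lemma Rintegral_cdf_comp : Rintegral mu setT (G \o X) = 1 / 2.
Proof.
pose A := [set z : T * T | X z.2 <= X z.1].
have mA : measurable A.
  have := @measurable_fun_le _ _ R setT (X \o snd) (X \o fst) measurableT.
  by rewrite setTI; apply; apply: measurableT_comp.
have := integral_sections mu mu mA.
have -> : (fun x => mu (xsection A x)) = EFin \o (G \o X).
  by apply/funext => t /=; rewrite -cdfG xsectionE.
have -> : (fun x => mu (ysection A x)) = EFin \o (fun t => 1 - G (X t)).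
  by apply/funext => t /=; rewrite -continuous_cdf_ge ysectionE.
have PT : (mu setT < +oo)%E by rewrite probability_setT ltry.
have iG : mu.-integrable setT (EFin \o (G \o X)).
  apply: (bounded_measurable_integrable PT (K := 1)).
    exact: measurableT_comp measurable_cdf mX.
  by move=> t; exact: cdf_norm_le1.
have i1 : mu.-integrable setT (EFin \o cst 1).
  apply: (bounded_measurable_integrable PT (K := 1)) => //.
  by move=> t; rewrite normr1.
move=> /(congr1 fine) => E.
have : Rintegral mu setT (G \o X) = Rintegral mu setT (cst 1 \- (G \o X)) by [].
rewrite RintegralB//.
have /= := Rintegral_cst mu measurableT 1; rewrite probability_setT mulr1 => ->.
lra.
Qed.

End continuous_cdf.

(** * Joint cdfs: measurability, survival function, symmetry of the cross integrals *)

Section joint_cdf_theory.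
Context {R : realType}.
Implicit Types (P Q : probability (R * R)%type R) (G H : R -> R).

Lemma joint_cdfE P x y :
  P [set z | z.1 <= x /\ z.2 <= y] = (joint_cdf P x y)%:E.
Proof.
rewrite /joint_cdf fineK; last first.
  by apply: fin_num_measure; apply: measurableX; exact: measurable_itv.
by congr (P _); apply/seteqP; split => -[a b] /=; rewrite !in_itv.
Qed.

Lemma marginal_cdf_fst P G H : has_marginal_cdfs P G H ->
  forall x, P [set z | z.1 <= x] = (G x)%:E.
Proof.
move=> [PG _] x; rewrite -PG.
by congr (P _); apply/seteqP; split => -[a b] /=; rewrite !in_itv//= => -[].
Qed.

Lemma marginal_cdf_snd P G H : has_marginal_cdfs P G H ->
  forall y, P [set z | z.2 <= y] = (H y)%:E.
Proof.
move=> [_ PH] y; rewrite -PH.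
by congr (P _); apply/seteqP; split => -[a b] /=; rewrite !in_itv//= => -[].
Qed.

Let dominated := [set w : (R * R) * (R * R) |
  w.2.1 <= w.1.1 /\ w.2.2 <= w.1.2].

Let measurable_dominated : measurable dominated.
Proof.
have m1 := @measurable_fun_le _ ((R * R) * (R * R))%type R setT
  (fst \o snd) (fst \o fst) measurableT.
have m2 := @measurable_fun_le _ ((R * R) * (R * R))%type R setT
  (snd \o snd) (snd \o fst) measurableT.
rewrite !setTI in m1 m2.
by apply: measurableI; [apply: m1|apply: m2]; exact: measurableT_comp.
Qed.

(** The value at [z] is the mass of the section of [dominated] at [z], and section masses of a
    measurable set depend measurably on the point. *)
Lemma measurable_joint_cdf P :
  measurable_fun setT (fun z : R * R => joint_cdf P z.1 z.2).
Proof.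
apply/measurable_EFinP.
have := measurable_fun_xsection P measurable_dominated.
congr (measurable_fun setT _).
by apply/funext => z /=; rewrite -joint_cdfE xsectionE.
Qed.

Lemma joint_cdf_norm_le1 P x y : `|joint_cdf P x y| <= 1.
Proof.
rewrite ger0_norm -lee_fin -joint_cdfE; last exact: measure_ge0.
rewrite joint_cdfE /joint_cdf fineK.
  apply: probability_le1.
  by apply: measurableX; exact: measurable_itv.
by apply: fin_num_measure; apply: measurableX; exact: measurable_itv.
Qed.

Section continuous_marginals.
Variables G H : R -> R.
Hypotheses (contG : continuous G) (contH : continuous H).

(** The closed upper quadrant [L] exceeds the complement of [A] union [B] only by boundary points on
    the lines [A0] and [B0], which are null by continuity of the marginals; inclusion-exclusion
    gives the rest. *)
Lemma joint_survivalE P x y : has_marginal_cdfs P G H ->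
  P [set z | x <= z.1 /\ y <= z.2] =
  (1 - G x - H y + joint_cdf P x y)%:E.
Proof.
move=> PGH.
pose A := [set z : R * R | z.1 <= x]; pose B := [set z : R * R | z.2 <= y].
pose A0 := [set z : R * R | z.1 = x]; pose B0 := [set z : R * R | z.2 = y].
pose L := [set z : R * R | x <= z.1 /\ y <= z.2].
have mle1 t : measurable [set z : R * R | z.1 <= t].
  have := @measurable_fun_le _ (R * R)%type R setT fst (cst t) measurableT.
  by rewrite setTI; apply.
have mle2 t : measurable [set z : R * R | z.2 <= t].
  have := @measurable_fun_le _ (R * R)%type R setT snd (cst t) measurableT.
  by rewrite setTI; apply.
have mA : measurable A := mle1 x.
have mB : measurable B := mle2 y.
have mL : measurable L.
  have m1 := @measurable_fun_le _ (R * R)%type R setT (cst x) fst measurableT.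
  have m2 := @measurable_fun_le _ (R * R)%type R setT (cst y) snd measurableT.
  by rewrite !setTI in m1 m2; apply: measurableI; [apply: m1|apply: m2].
have cG := marginal_cdf_fst PGH; have cH := marginal_cdf_snd PGH.
have mA0 : measurable A0 by apply: measurable_atom.
have mB0 : measurable B0 by apply: measurable_atom.
have PA0 : P A0 = 0%E by apply: (continuous_cdf_atomless _ cG contG).
have PB0 : P B0 = 0%E by apply: (continuous_cdf_atomless _ cH contH).
have mN : measurable (L `&` (A0 `|` B0)).
  by apply: measurableI => //; exact: measurableU.
have PN : P (L `&` (A0 `|` B0)) = 0%E.
  apply: (@subset_measure0 _ _ _ P _ (A0 `|` B0)) => //.
  - exact: measurableU.
  - exact: (@null_set_setU _ _ _ P _ _ mA0 mB0 PA0 PB0).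
transitivity (P (~` (A `|` B))).
  transitivity (P (~` (A `|` B) `|` (L `&` (A0 `|` B0)))).
    congr (P _); apply/seteqP; split => -[a b] /=; rewrite /A /B /L /A0 /B0 /=.
      move=> [xa yb]; have [ax|xa'] := eqVneq a x; first by right; split; [|left].
      have [by'|yb'] := eqVneq b y; first by right; split; [|right].
      left=> -[]; apply/negP; rewrite -ltNge lt_neqAle eq_sym.
        by rewrite xa'.
      by rewrite yb'.
    case=> [/not_orP[/negP + /negP]|[[]]//].
    by rewrite -!ltNge => /ltW ? /ltW.
  by apply: measureU0 => //; apply: measurableC; exact: measurableU.
rewrite probability_setC; last exact: measurableU.
have -> : P (A `|` B) = (P A + P B - P (A `&` B))%E.
  by apply: measureUfinl => //; rewrite [ltLHS]cG ltry.
have -> : P (A `&` B) = (joint_cdf P x y)%:E by exact: joint_cdfE.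
by rewrite cG cH; congr (_%:E); lra.
Qed.

(* Fubini's theorem on the set of pairs (z, z') with z' <= z coordinatewise
   gives [E_Q F_P = E_P (1 - G - H) + E_P F_Q]; the case [P = Q] shows that
   the additional term vanishes. *)
Lemma Rintegral_joint_cdfC P Q :
  has_marginal_cdfs P G H -> has_marginal_cdfs Q G H ->
  Rintegral Q setT (fun z => joint_cdf P z.1 z.2) =
  Rintegral P setT (fun z => joint_cdf Q z.1 z.2).
Proof.
move=> PGH QGH.
pose K := Rintegral P setT (fun z => 1 - G z.1 - H z.2).
have PT : (P setT < +oo)%E by rewrite probability_setT ltry.
suff key Q' : has_marginal_cdfs Q' G H ->
    Rintegral Q' setT (fun z => joint_cdf P z.1 z.2) =
    K + Rintegral P setT (fun z => joint_cdf Q' z.1 z.2).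
  have := key _ PGH; have := key _ QGH; lra.
move=> Q'GH.
rewrite /K -RintegralD//; first last.
- apply: (bounded_measurable_integrable PT (K := 1)).
    exact: measurable_joint_cdf.
  by move=> z; exact: joint_cdf_norm_le1.
- have cG := marginal_cdf_fst PGH; have cH := marginal_cdf_snd PGH.
  have mG : measurable_fun setT G by apply: measurable_cdf cG.
  have mH : measurable_fun setT H by apply: measurable_cdf cH.
  apply: (bounded_measurable_integrable PT (K := 3)).
    apply: measurable_funB; [apply: measurable_funB => //|];
      exact: measurableT_comp.
  move=> z.
  have : `|G z.1| <= 1 by apply: cdf_norm_le1 cG _.
  have : `|H z.2| <= 1 by apply: cdf_norm_le1 cH _.
  rewrite !ler_norml => /andP[? ?] /andP[? ?]; apply/andP; split; lra.
have := integral_sections Q' P measurable_dominated.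
have -> : (fun z => P (xsection dominated z)) =
    EFin \o (fun z => joint_cdf P z.1 z.2).
  by apply/funext => z /=; rewrite -joint_cdfE xsectionE.
have -> : (fun z => Q' (ysection dominated z)) =
    EFin \o (fun z => 1 - G z.1 - H z.2 + joint_cdf Q' z.1 z.2).
  by apply/funext => z /=; rewrite -joint_survivalE// ysectionE.
by move=> /(congr1 fine).
Qed.

End continuous_marginals.

End joint_cdf_theory.

(** * Mean value estimates in the parameter, and the cross difference *)

Section difference_quotients.
Context {R : realType}.
Implicit Types (I : set R) (f : R -> R).

(** The endpoints come in either order, since the parameter may have either sign. Membership of [c]
    in [I] gives access to the derivative bounds; its position between the endpoints gives
    [|c| <= |a|] when one of them is 0. *)
Lemma MVT_is_interval I f a b : is_interval I ->
  (forall x, I x -> derivable f x 1) -> I a -> I b ->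
  exists c, [/\ I c, Num.min a b <= c, c <= Num.max a b &
    f b - f a = derive1 f c * (b - a)].
Proof.
move=> itvI df.
wlog ab : a b / a <= b => [hwlog|].
  have [ab|/ltW ba] := leP a b; first by move=> Ia Ib; have := hwlog _ _ ab Ia Ib;
    rewrite (min_idPl ab) (max_idPr ab).
  move=> Ia Ib; have [c [Ic c1 c2 E]] := hwlog _ _ ba Ib Ia.
  rewrite (min_idPl ba) in c1; rewrite (max_idPr ba) in c2.
  exists c; split => //.
  by rewrite -(opprB (f a)) E; ring.
move=> Ia Ib.
have Iab x : x \in `[a, b] -> I x by rewrite in_itv/= => ?; exact: itvI Ia Ib _ _.
have [||c cab E] := @MVT_segment R f (derive1 f) a b ab.
- move=> x xab; rewrite derive1E; apply: DeriveDef => //; apply/df/Iab.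
  by move: xab; rewrite !in_itv/= => /andP[/ltW -> /ltW ->].
- apply: continuous_in_subspaceT => x; rewrite inE => xab.
  by apply/differentiable_continuous/derivable1_diffP/df/Iab.
- exists c; split => //; first exact: Iab; move: cab;
    by rewrite in_itv/= ?(min_idPl ab) ?(max_idPr ab) => /andP[].
Qed.

Variables (I : set R) (f : R -> R) (M : R).
Hypotheses (itvI : is_interval I) (I0 : I 0).
Hypothesis df : forall x, I x -> derivable f x 1 /\ derivable (derive1 f) x 1.
Hypothesis fM : forall x, I x -> `|derive1 f x| <= M /\ `|derive1n 2 f x| <= M.

Let mvt0 a : I a -> exists c, [/\ I c, `|c| <= `|a| & f a - f 0 = derive1 f c * a].
Proof.
move=> Ia.
have [c [Ic c1 c2]] := MVT_is_interval itvI (fun x Ix => (df Ix).1) I0 Ia.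
rewrite subr0 => E; exists c; split => //.
move: c1 c2; rewrite minEle maxEle; case: ifPn => [a0 c0 ca|].
  by rewrite !ger0_norm.
by rewrite -ltNge => /ltW a0 ac c0; rewrite !ler0_norm// lerN2.
Qed.

Lemma increment_bound a : I a -> `|f a - f 0| <= M * `|a|.
Proof.
move=> /mvt0[c [Ic _ ->]]; rewrite normrM ler_wpM2r//.
exact: (fM Ic).1.
Qed.

(** The quotients are values of the first derivative at points [x], [y] with [|x| <= |a|] and
    [|y| <= |b|]. A second use of the mean value theorem, now on the derivative, bounds their
    difference by [M * |x - y|]. *)
Lemma difference_quotient_bound a b : I a -> I b -> a != 0 -> b != 0 ->
  `|(f a - f 0) / a - (f b - f 0) / b| <= M * (`|a| + `|b|).
Proof.
move=> /mvt0[x [Ix xa ->]] /mvt0[y [Iy yb ->]] a0 b0.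
rewrite !mulfK//.
have [c [Ic _ _ ->]] := MVT_is_interval itvI (fun x Ix => (df Ix).2) Iy Ix.
have M0 : 0 <= M := le_trans (normr_ge0 _) (fM I0).1.
rewrite normrM; apply: ler_pM => //; first exact: (fM Ic).2.
by apply: le_trans (ler_normB _ _) _; exact: lerD.
Qed.

End difference_quotients.

(* With [q_t = (E t - E 0) / t], the quantity is [q_t t - q_t 0], which differs
   from [q_c t - q_c 0] by [O(|t| + |c|)]; for fixed [c], symmetry of [E] turns
   the latter into [((E t c - E 0 c) - (E t 0 - E 0 0)) / c = O(t)]. *)
Lemma cvg_cross_difference (R : realType) (E : R -> R -> R) (I : set R) (M : R) :
  nbhs 0 I ->
  (forall a b, I a -> I b -> E a b = E b a) ->
  (forall a b, I a -> I b -> `|E a b - E 0 b| <= M * `|a|) ->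
  (forall a c b, I a -> I c -> I b -> a != 0 -> c != 0 ->
    `|(E a b - E 0 b) / a - (E c b - E 0 b) / c| <= M * (`|a| + `|c|)) ->
  t^-1 * (E t t - E 0 t - (E t 0 - E 0 0)) @[t --> 0^'] --> (0 : R).
Proof.
move=> I0 Esym E1 E2.
have II0 : I 0 by exact: nbhs_singleton.
have /nbhs_ballP[r /= r0 rI] := I0.
(* [N] dominates [M] and is positive whatever the sign of [M], so [c] can be chosen by dividing by
   it. The choice of [c] ensures that [c] lies in [I] and that [N * c <= e / 8]. *)
pose N := `|M| + 1.
have N0 : 0 < N by rewrite ltr_wpDl.
have MN : M <= N by rewrite (le_trans (ler_norm M))// lerDl.
apply/cvgr0Pnorm_le => e e0.
pose c := Num.min (r / 2) (e / (8 * N)).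
have c0 : 0 < c by rewrite lt_min !divr_gt0// mulr_gt0.
have cr : c < r by rewrite /c gt_min; apply/orP; left; lra.
have cN : N * c <= e / 8.
  have : c <= e / (8 * N) by rewrite /c ge_min lexx orbT.
  by rewrite invfM mulrA ler_pdivlMr// mulrC.
have Ic : I c by apply: rI; rewrite /ball /= sub0r normrN gtr0_norm.
near=> t.
have t0 : t != 0 by near: t; exact: nbhs_dnbhs_neq.
have It : I t by near: t; exact: nbhs_dnbhs.
have tc : `|t| < c by near: t; exact: dnbhs0_lt.
(* In [hq] two increments of size at most [M * |t|] are divided by [c]; this bound on [t] keeps the
   result below [2 * N * c], hence below [e / 4]. *)
have tc2 : `|t| < c * c by near: t; apply: dnbhs0_lt; exact: mulr_gt0.
have cn0 : c != 0 by rewrite gt_eqF.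
have hb b : I b -> `|(E t b - E 0 b) / t - (E c b - E 0 b) / c| <= e / 4.
  move=> Ib; apply: le_trans (E2 _ _ _ It Ic Ib t0 cn0) _.
  rewrite (gtr0_norm c0).
  apply: (@le_trans _ _ (N * (c + c))); last lra.
  apply: (@le_trans _ _ (N * (`|t| + c))).
    by rewrite ler_wpM2r// addr_ge0// ltW.
  by rewrite ler_wpM2l ?(ltW N0)// lerD2r ltW.
have hq : `|(E c t - E 0 t) / c - (E c 0 - E 0 0) / c| <= e / 4.
  (* Symmetry moves [t] to the first argument, where increments are controlled. *)
  have -> : (E c t - E 0 t) / c - (E c 0 - E 0 0) / c =
      ((E t c - E 0 c) - (E t 0 - E 0 0)) / c.
    by rewrite (Esym c t)// (Esym 0 t)// (Esym c 0)//; ring.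
  rewrite normrM normfV (gtr0_norm c0) ler_pdivrMr//.
  apply: le_trans (ler_normB _ _) _.
  have h1 := E1 _ _ It Ic; have h2 := E1 _ _ It II0.
  have h3 : M * `|t| <= N * (c * c).
    apply: (@le_trans _ _ (N * `|t|)); first by rewrite ler_wpM2r.
    by rewrite ler_wpM2l ?(ltW N0)// ltW.
  have h4 : N * (c * c) <= e / 8 * c by rewrite mulrA ler_wpM2r// ltW.
  lra.
(* In both columns [t] and 0, the quotient with step [t] is replaced by the one with step [c]. The
   three resulting terms are at most [e / 4] each. *)
have -> : t^-1 * (E t t - E 0 t - (E t 0 - E 0 0)) =
  ((E t t - E 0 t) / t - (E c t - E 0 t) / c) -
  ((E t 0 - E 0 0) / t - (E c 0 - E 0 0) / c) +
  ((E c t - E 0 t) / c - (E c 0 - E 0 0) / c) by ring.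
have := hb _ It; have := hb _ II0; move: hq.
rewrite !ler_norml => /andP[? ?] /andP[? ?] /andP[? ?].
by apply/andP; split; lra.
Unshelve. all: by end_near. Qed.

(** * Continuous cdfs on the line and their Lebesgue-Stieltjes measures *)

Section cumulative_bounded.
Context {R : realType}.
Implicit Types G H : cumulativeBounded (0 : R) (1 : R).

Lemma cumulativeBounded_ivt G v : continuous G -> 0 < v -> v < 1 ->
  exists x, G x = v.
Proof.
move=> cG v0 v1.
have [a Ga] : exists a, G a < v.
  have /cvgrPdist_lt /(_ v v0) [a [_ aG]] := cumulativeNy G.
  (* Neighborhoods of infinity are given by strict bounds; the shift by 1 yields a point inside. *)
  exists (a - 1); have := aG (a - 1) _; rewrite ltrBlDr ltrDl ltr01 => /(_ isT).
  by rewrite sub0r normrN => /(le_lt_trans (ler_norm _)).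
have [b Gb] : exists b, v < G b.
  have v1' : 0 < 1 - v by rewrite subr_gt0.
  have /cvgrPdist_lt /(_ _ v1') [b [_ bG]] := cumulativey G.
  exists (b + 1); have := bG (b + 1) _; rewrite ltrDl ltr01 => /(_ isT).
  by move=> /(le_lt_trans (ler_norm _)); rewrite ltrD2l ltrN2.
have ab : a <= b.
  rewrite leNgt; apply/negP => /ltW /(cumulative_is_nondecreasing G).
  by rewrite leNgt (lt_trans Ga Gb).
have Gab : G a <= G b by exact: cumulative_is_nondecreasing.
have [||x _ <-] := @IVT R G a b v ab.
- exact: continuous_subspaceT.
- by rewrite (min_idPl Gab) (max_idPr Gab) !ltW.
- by exists x.
Qed.

(** Since [H] tends to 1, some [b] has [H b > 0]; then [g] is the slice of [F] at [b] divided by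
    [H b]. This extracts continuity of the marginals from that of the joint cdf. *)
Lemma continuous_product_cdf_fst (F : R -> R -> R) (g : R -> R) H :
  continuous (fun z : R * R => F z.1 z.2) ->
  (forall x y, F x y = g x * H y) -> continuous g.
Proof.
move=> cF FgH.
have [b Hb] : exists b, 0 < H b.
  have /cvgrPdist_lt /(_ 1 ltr01) [b [_ bH]] := cumulativey H.
  exists (b + 1); have := bH (b + 1) _; rewrite ltrDl ltr01 => /(_ isT).
  by move=> /(le_lt_trans (ler_norm _)); rewrite ltrBlDr ltrDl.
have -> : g = fun x => F x b * (H b)^-1.
  by apply/funext => x; rewrite FgH mulfK// gt_eqF.
move=> x; apply: cvgM; last exact: cvg_cst.
apply: (@continuous_comp _ _ _ (fun x => (x, b)) (fun z => F z.1 z.2) x).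
  exact: (cvg_pair (@cvg_id _ (nbhs x)) (@cvg_cst _ b _ (nbhs x) _)).
exact: cF.
Qed.

(** The identity, under the measure of [G], has the continuous cdf [G], so [G] has mean 1/2. At
    independence this evaluates the two partial integrals inside [sigma2_S]. *)
Lemma Rintegral_lebesgue_stieltjes_cdf G (c : R) : continuous G ->
  Rintegral (lebesgue_stieltjes_measure G) [set: R] (fun x => c * G x) = c / 2.
Proof.
move=> cG.
pose mu : probability (measurableTypeR R) R := lebesgue_stieltjes_measure G.
have mid : @measurable_fun _ _ (measurableTypeR R) R setT idfun.
  exact: measurable_id.
have cdfG x : mu [set t | idfun t <= x] = (G x)%:E.
  rewrite -cdf_lebesgue_stieltjes_id /cdf /distribution /pushforward /=.
  by congr (mu _); apply/seteqP; split => t /=; rewrite in_itv.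
have half := Rintegral_cdf_comp mid cdfG cG.
have mG : measurable_fun setT G by apply: measurable_cdf cdfG.
have iG : mu.-integrable setT (EFin \o (G \o idfun)).
  apply: (bounded_measurable_integrable (K := 1)).
  - by rewrite [ltLHS](@probability_setT _ _ _ mu) ltry.
  - exact: measurableT_comp mG mid.
  - by move=> t; exact: (cdf_norm_le1 mid cdfG).
transitivity (Rintegral mu setT (fun x => c * (G \o idfun) x)) => //.
by rewrite RintegralZl// half; lra.
Qed.

End cumulative_bounded.

(** * The variances at independence *)

Section independence_variance.
Context {R : realType}.
Variables (P : probability (R * R)%type R).
Variables (G H : cumulativeBounded (0 : R) (1 : R)).
Hypotheses (contG : continuous G) (contH : continuous H).
Hypothesis PGH : has_marginal_cdfs P G H.
Hypothesis FGH : forall x y, joint_cdf P x y = G x * H y.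

Let Z (z : R * R) := 2 * (G z.1 * H z.2) - G z.1 - H z.2.

Let cG := marginal_cdf_fst PGH.
Let cH := marginal_cdf_snd PGH.

Let mZ : measurable_fun setT Z.
Proof.
have mG : measurable_fun setT G by apply: measurable_cdf cG.
have mH : measurable_fun setT H by apply: measurable_cdf cH.
have mG1 : measurable_fun setT (fun z : R * R => G z.1).
  exact: measurableT_comp.
have mH2 : measurable_fun setT (fun z : R * R => H z.2).
  exact: measurableT_comp.
apply: measurable_funB => //; apply: measurable_funB => //.
by apply: measurable_funM => //; apply: measurable_funM.
Qed.

Let G01 x : 0 <= G x <= 1.
Proof.
rewrite -!lee_fin -cG measure_ge0/=; apply: probability_le1.
have := @measurable_fun_le _ (R * R)%type R setT fst (cst x) measurableT.
by rewrite setTI; apply.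
Qed.

Let H01 y : 0 <= H y <= 1.
Proof.
rewrite -!lee_fin -cH measure_ge0/=; apply: probability_le1.
have := @measurable_fun_le _ (R * R)%type R setT snd (cst y) measurableT.
by rewrite setTI; apply.
Qed.

Let Zbnd z : `|Z z| <= 4.
Proof.
have /andP[? ?] := G01 z.1; have /andP[? ?] := H01 z.2.
by rewrite ler_norml /Z; apply/andP; split; nra.
Qed.

Let ZL2 : Z \in Lfun P 2%:E.
Proof. exact: (bounded_measurable_Lfun2 P mZ Zbnd). Qed.

(* With [U = G X] and [V = H Y], [Z = ((2 U - 1) (2 V - 1) - 1) / 2] is at
   least [- 3 / 8] when [U, V <= 1 / 4] and at most [- 5 / 8] when [U <= 1 / 4]
   and [V >= 3 / 4]; both events have probability [1 / 16], so by Chebyshev's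
   inequality the variance cannot vanish. *)
Lemma variance_independent_neq0 : fine 'V_P[Z] != 0.
Proof.
apply/eqP => V0.
have {}V0 : 'V_P[Z] = 0%E by rewrite -[LHS]fineK ?V0//; exact: variance_fin_num.
have [xa Gxa] : exists x, G x = 1 / 4 by apply: cumulativeBounded_ivt => //; lra.
have [ya Hya] : exists y, H y = 1 / 4 by apply: cumulativeBounded_ivt => //; lra.
have [yb Hyb] : exists y, H y = 3 / 4 by apply: cumulativeBounded_ivt => //; lra.
pose X : {RV P >-> R} := HB.pack Z (isMeasurableFun.Build _ _ _ _ Z mZ).
have e0 : (0 : R) < 1 / 8 by lra.
have := chebyshev X e0.
rewrite [X in (_ <= _ * X)%E]V0 mule0 => cheb.
set m := fine _ in cheb.
pose A := [set z : R * R | z.1 <= xa].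
pose B1 := [set z : R * R | z.1 <= xa /\ z.2 <= ya].
pose B2 := [set z : R * R | z.1 <= xa /\ z.2 <= yb].
have PB1 : P B1 = (1 / 16)%:E.
  by rewrite [LHS]joint_cdfE FGH Gxa Hya; congr (_%:E); lra.
have PB2 : P B2 = (3 / 16)%:E.
  by rewrite [LHS]joint_cdfE FGH Gxa Hyb; congr (_%:E); lra.
have PA : P A = (1 / 4)%:E by rewrite [LHS]cG Gxa.
have mle1 t : measurable [set z : R * R | z.1 <= t].
  have := @measurable_fun_le _ (R * R)%type R setT fst (cst t) measurableT.
  by rewrite setTI; apply.
have mle2 t : measurable [set z : R * R | z.2 <= t].
  have := @measurable_fun_le _ (R * R)%type R setT snd (cst t) measurableT.
  by rewrite setTI; apply.
have mA : measurable A := mle1 xa.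
have mB1 : measurable B1 := measurableI _ _ (mle1 xa) (mle2 ya).
have mB2 : measurable B2 := measurableI _ _ (mle1 xa) (mle2 yb).
have PAB : P (A `\` B2) = (1 / 16)%:E.
  have -> : P (A `\` B2) = (P A - P (A `&` B2))%E.
    by apply: measureD => //; rewrite [ltLHS]PA ltry.
  have -> : A `&` B2 = B2 by apply: setIidr => z [].
  by rewrite PA PB2; congr (_%:E); lra.
have mC : measurable [set z | 1 / 8 <= `|X z - m|].
  have := @measurable_fun_le _ (R * R)%type R setT (cst (1 / 8))
    (fun z => `|X z - m|) measurableT.
  rewrite setTI; apply=> //; apply: measurableT_comp => //.
  exact: measurable_funB.
(* With zero variance, deviations of at least 1/8 from the mean form a null event, which cannot
   contain an event of mass 1/16. *)
have absurd_of (B : set (R * R)) : measurable B -> P B = (1 / 16)%:E ->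
    ~ (forall z, B z -> 1 / 8 <= `|Z z - m|).
  move=> mB PB sub.
  have : (P B <= 0)%E.
    by apply: le_trans cheb; apply: le_measure; rewrite ?inE.
  by rewrite PB lee_fin; lra.
have ndG : {homo G : x y / x <= y} := cumulative_is_nondecreasing G.
have ndH : {homo H : x y / x <= y} := cumulative_is_nondecreasing H.
(* The threshold is the midpoint of -5/8 and -3/8: wherever the mean lies, the values of [Z] on one
   of the two events are at least 1/8 away from it. *)
have [mle|mgt] := leP m (- (1 / 2)).
- apply: (absurd_of _ mB1 PB1) => z [/ndG + /ndH]; rewrite Gxa Hya => ? ?.
  have /andP[? ?] := G01 z.1; have /andP[? ?] := H01 z.2.
  by apply: le_trans (ler_norm _); rewrite /Z; nra.
- apply: (absurd_of _ (measurableD mA mB2) PAB) => z [/[dup] Az /ndG + nB].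
  have : H yb <= H z.2.
    by apply: ndH; rewrite leNgt; apply/negP => /ltW zb; apply: nB.
  rewrite Gxa Hyb => ? ?.
  have /andP[? ?] := G01 z.1; have /andP[? ?] := H01 z.2.
  by rewrite distrC; apply: le_trans (ler_norm _); rewrite /Z; nra.
Qed.

(** The left-hand statistic is [1 + Z / 2], as expanding the product shows. *)
Lemma variance_half_affine :
  fine 'V_P[fun z => (1 - G z.1) * (1 - H z.2) + G z.1 / 2 + H z.2 / 2] =
  fine 'V_P[Z] / 4.
Proof.
have -> : (fun z => (1 - G z.1) * (1 - H z.2) + G z.1 / 2 + H z.2 / 2) =
    (cst 1 \+ (2^-1 \o* Z)).
  by apply/funext => z /=; rewrite /Z; field.
have L : (2^-1 \o* Z) \in Lfun P 2%:E by apply: Lfun_scale => //; rewrite ler1n.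
rewrite varianceD_cst_l// varianceZ// fineM//; last exact: variance_fin_num.
by rewrite /=; field.
Qed.

End independence_variance.

(** * Limits at 0, the variance ratio and the final computation *)

(** The lower limit is minus the upper limit of [- f]; if the latter is negative, so is the supremum
    [s] of [- f] on some punctured neighborhood, and any positive [c <= - s] serves. When [s] is
    [-oo], the value 1 is taken. *)
Lemma lime_inf_gt0_near (R : realType) (f : R -> \bar R) (a : R) :
  (0 < lime_inf f a)%E ->
  exists2 c : R, 0 < c & \forall x \near a^', (c%:E <= f x)%E.
Proof.
rewrite /lime_inf lteNr oppe0 /lime_sup /limf_esup => /ereal_inf_lt[_ [V aV <-]].
set s := ereal_sup _ => s0.
have fs x : V x -> (- s <= f x)%E.
  move=> Vx; rewrite leeNl; apply: ereal_sup_ubound => /=.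
  by exists x.
have [c c0 cs] : exists2 c : R, 0 < c & (c%:E <= - s)%E.
  case: s s0 {fs} => [r| |]//=.
  - by rewrite lte_fin => r0; exists (- r); [rewrite oppr_gt0|rewrite EFinN].
  - by move=> _; exists 1 => //; rewrite leey.
exists c => //; near=> x; apply: (le_trans cs); apply: fs.
by near: x.
Unshelve. all: by end_near. Qed.

(** Here [f] is o(t) while [|g t|] is at least [c * |t|]; both are compared after division by
    [t]. *)
Lemma cvg_quotient_rate0 (R : realType) (f g : R -> R) (c : R) : 0 < c ->
  t^-1 * f t @[t --> 0^'] --> (0 : R) ->
  (\forall t \near 0^', c <= `|t^-1 * g t|) ->
  f t / g t @[t --> 0^'] --> (0 : R).
Proof.
move=> c0 f0 gc; apply/cvgr0Pnorm_le => e e0.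
move/cvgr0Pnorm_le : f0 => /(_ (c * e) (mulr_gt0 c0 e0)) f0.
near=> t.
have t0 : t != 0 by near: t; exact: nbhs_dnbhs_neq.
have ft : `|t^-1 * f t| <= c * e by near: t.
have gt : c <= `|t^-1 * g t| by near: t.
have g0 : g t != 0.
  by apply: contraTN gt => /eqP ->; rewrite mulr0 normr0 -ltNge.
have -> : f t / g t = (t^-1 * f t) / (t^-1 * g t) by field; rewrite g0 t0.
rewrite normrM normfV ler_pdivrMr; last exact: lt_le_trans gt.
by apply: (le_trans ft); rewrite mulrC ler_wpM2l// ltW.
Unshelve. all: by end_near. Qed.

Lemma fine_expectationE (d : measure_display) (T : measurableType d)
    (R : realType) (P : probability T R) (f : T -> R) :
  fine 'E_P[f] = Rintegral P setT f.
Proof. by rewrite unlock. Qed.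

(** With [v] the variance of [Z], the ratio is [(144 * v / 4) / (16 * v)]; cancelling [v] requires
    that it be nonzero. *)
Lemma sigma2_ratio (R : realType) (P : R -> probability (R * R)%type R)
    (G H : cumulativeBounded (0 : R) (1 : R)) :
  continuous G -> continuous H -> has_marginal_cdfs (P 0) G H ->
  (forall x y, joint_cdf (P 0) x y = G x * H y) ->
  sigma2_S P G H 0 / sigma2_T P G H 0 = 9 / 4.
Proof.
move=> contG contH PGH FGH; rewrite /sigma2_S /sigma2_T.
have -> : (fun z : R * R => 2 * joint_cdf (P 0) z.1 z.2 - G z.1 - H z.2) =
    (fun z => 2 * (G z.1 * H z.2) - G z.1 - H z.2).
  by apply/funext => z; rewrite FGH.
have -> : (fun z : R * R => (1 - G z.1) * (1 - H z.2)
    + Rintegral (lebesgue_stieltjes_measure H) [set: R]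
        (fun y => joint_cdf (P 0) z.1 y)
    + Rintegral (lebesgue_stieltjes_measure G) [set: R]
        (fun x => joint_cdf (P 0) x z.2)) =
    (fun z => (1 - G z.1) * (1 - H z.2) + G z.1 / 2 + H z.2 / 2).
  apply/funext => z; congr (_ + _ + _).
  - by rewrite -(Rintegral_lebesgue_stieltjes_cdf (G z.1) contH);
      apply: eq_Rintegral => y _; rewrite FGH.
  - by rewrite -(Rintegral_lebesgue_stieltjes_cdf (H z.2) contG);
      apply: eq_Rintegral => x _; rewrite FGH mulrC.
rewrite (variance_half_affine PGH).
have := variance_independent_neq0 contG contH PGH FGH.
by set v := fine _ => v0; field.
Qed.

Theorem corollary4p8 (R : realType) (Theta Theta0 : set R)
    (P : R -> probability (R * R)%type R)
    (G H : cumulativeBounded (0 : R) (1 : R)) :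
  let F := fun theta : R => joint_cdf (P theta) in
  is_interval Theta -> open Theta -> Theta 0 ->
  (forall theta, Theta theta ->
     continuous (fun z : R * R => F theta z.1 z.2)) ->
  (forall theta, Theta theta -> has_marginal_cdfs (P theta) G H) ->
  (forall x y, F 0 x y = G x * H y) ->
  is_interval Theta0 -> open Theta0 -> Theta0 0 -> Theta0 `<=` Theta ->
  (forall theta x y, Theta0 theta ->
     derivable (fun t => F t x y) theta 1 /\
     derivable (derive1 (fun t => F t x y)) theta 1) ->
  (exists M : R, forall theta x y, Theta0 theta ->
     `| derive1 (fun t => F t x y) theta | <= M /\
     `| derive1n 2 (fun t => F t x y) theta | <= M) ->
  (theta^-1 *
     charge_integral (probability_diff (P theta) (P 0))
       (fun z => F theta z.1 z.2 - F 0 z.1 z.2)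
     @[theta --> 0^'] --> (0 : R)) /\
  ((0 < lime_inf (fun theta =>
      `| theta^-1 *
         Rintegral (P 0) [set: R * R]
           (fun z => F theta z.1 z.2 - F 0 z.1 z.2) |%:E) 0%R)%E ->
   cvg (mean_shift_ratio P G H theta @[theta --> 0^']) /\
   ARE_TS P G H = 1).
Proof.
move=> F _ _ Theta_0 contF PGH FGH itv0 open0 Theta0_0 sub0 dF [M FM].
have contG : continuous G.
  exact: (continuous_product_cdf_fst (contF _ Theta_0) FGH).
have contH : continuous H.
  (* The same slicing argument with the two coordinates exchanged. *)
  apply: (@continuous_product_cdf_fst _ (fun y x => F 0 x y) _ G); last first.
    by move=> y x; rewrite FGH mulrC.
  move=> z.
  apply: (@continuous_comp _ _ _ (fun z => (z.2, z.1)) (fun z => F 0 z.1 z.2)).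
    exact: (cvg_pair (@cvg_snd _ _ (nbhs z.1) (nbhs z.2) _)
                     (@cvg_fst _ _ (nbhs z.1) (nbhs z.2) _)).
  exact: contF.
have nb0 : nbhs 0 Theta0 by apply: open_nbhs_nbhs.
pose E a b := Rintegral (P b) setT (fun z => F a z.1 z.2).
have mF a : measurable_fun setT (fun z : R * R => F a z.1 z.2).
  exact: measurable_joint_cdf.
have PT b : (P b setT < +oo)%E by rewrite probability_setT ltry.
have iF a b : (P b).-integrable setT (EFin \o (fun z => F a z.1 z.2)).
  apply: (bounded_measurable_integrable (PT b) (K := 1)) => // z.
  exact: joint_cdf_norm_le1.
have EB a b c : Rintegral (P c) setT (fun z => F a z.1 z.2 - F b z.1 z.2) =
    E a c - E b c.
  by apply: RintegralB => //; exact: iF.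
have Esym a b : Theta0 a -> Theta0 b -> E a b = E b a.
  move=> /sub0 ta /sub0 tb.
  by apply: (Rintegral_joint_cdfC contG contH); exact: PGH.
(* [D t] is the integral of [F t - F 0] against the signed measure, by [chargeE] below, and [A t]
   its integral against [P 0]. *)
pose D t := E t t - E 0 t - (E t 0 - E 0 0).
pose A t := E t 0 - E 0 0.
have D0 : t^-1 * D t @[t --> 0^'] --> (0 : R).
  apply: (cvg_cross_difference (I := Theta0) (M := M)) => //.
  - move=> a b ta tb; rewrite -EB.
    apply: normr_Rintegral_le; first exact: measurable_funB.
    move=> z; apply: (increment_bound (I := Theta0) (f := fun t => F t z.1 z.2)) => //.
    + by move=> x; exact: dF.
    + by move=> x; exact: FM.
  - move=> a c b ta tc tb a0 c0; rewrite -!EB.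
    have mB x : measurable_fun setT (fun z => F x z.1 z.2 - F 0 z.1 z.2).
      exact: measurable_funB.
    have iB x : (P b).-integrable setT
        (EFin \o (fun z => F x z.1 z.2 - F 0 z.1 z.2)).
      by have := integrableB measurableT (iF x b) (iF 0 b).
    have mZ x r : measurable_fun setT (fun z => (F x z.1 z.2 - F 0 z.1 z.2) / r).
      by apply: measurable_funM.
    have iZ x r : (P b).-integrable setT
        (EFin \o (fun z => (F x z.1 z.2 - F 0 z.1 z.2) / r)).
      apply: (bounded_measurable_integrable (PT b) (K := 2 * `|r^-1|)) => // z.
      rewrite normrM ler_wpM2r//; apply: (le_trans (ler_normB _ _)).
      have := joint_cdf_norm_le1 (P x) z.1 z.2.
      have := joint_cdf_norm_le1 (P 0) z.1 z.2.
      by rewrite -/(F x) -/(F 0); lra.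
    rewrite -!RintegralZr// -RintegralB//.
    apply: normr_Rintegral_le; first exact: measurable_funB.
    move=> z.
    apply: (difference_quotient_bound (I := Theta0) (f := fun t => F t z.1 z.2)) => //.
    + by move=> x; exact: dF.
    + by move=> x; exact: FM.
have chargeE t : charge_integral (probability_diff (P t) (P 0))
    (fun z => F t z.1 z.2 - F 0 z.1 z.2) = D t.
  rewrite (charge_integral_probability_diff (P t) (P 0) (K := 2)) ?EB//.
    exact: measurable_funB.
  move=> z; apply: (le_trans (ler_normB _ _)).
  have := joint_cdf_norm_le1 (P t) z.1 z.2.
  have := joint_cdf_norm_le1 (P 0) z.1 z.2.
  by rewrite -/(F t) -/(F 0); lra.
split.
  by apply: cvg_trans D0; apply: near_eq_cvg; near=> t; rewrite chargeE.
move=> /lime_inf_gt0_near[c c0 Ac].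
have {}Ac : \forall t \near 0^', c <= `|t^-1 * A t|.
  by apply: filterS Ac => t; rewrite EB lee_fin.
have DA0 : D t / A t @[t --> 0^'] --> (0 : R) by exact: cvg_quotient_rate0 D0 Ac.
have ratio : mean_shift_ratio P G H t @[t --> 0^'] --> (4 / 9 : R).
  (* This is the mean shift ratio [(4 * (D t + 2 * A t)) ^+ 2 / (12 * A t) ^+ 2] after cancelling
     [A t], which is nonzero near 0. *)
  have lim : (D t / A t + 2) ^+ 2 / 9 @[t --> 0^'] --> (4 / 9 : R).
    have -> : (4 / 9 : R) = (0 + 2) ^+ 2 / 9 by field.
    apply: cvgM; last exact: cvg_cst.
    rewrite expr2; under eq_fun do rewrite expr2.
    by apply: cvgM; apply: cvgD => //; exact: cvg_cst.
  apply: cvg_trans lim; apply: near_eq_cvg; near=> t.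
  have tT : Theta0 t by near: t; exact: nbhs_dnbhs.
  have At : A t != 0.
    have : c <= `|t^-1 * A t| by near: t.
    by apply: contraTN => /eqP ->; rewrite mulr0 normr0 -ltNge.
  rewrite /mean_shift_ratio /mu_T /mu_S !fine_expectationE.
  (* Independence at 0 turns the mean in [mu_S t] into [E 0 t], which symmetry identifies with
     [E t 0]. *)
  have GHE : (fun z : R * R => G z.1 * H z.2) = (fun z => F 0 z.1 z.2).
    by apply/funext => z; rewrite FGH.
  rewrite GHE -/(F t) -/(F 0) -!/(E _ _) (Esym 0 t)//.
  have -> : 4 * E t t - 1 - (4 * E 0 0 - 1) = 4 * (D t + 2 * A t).
    by rewrite /D /A (Esym 0 t)//; ring.
  have -> : 12 * E t 0 - 3 - (12 * E 0 0 - 3) = 12 * A t by rewrite /A; ring.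
  by field.
split; first by apply/cvg_ex; exists (4 / 9).
rewrite /ARE_TS (cvg_lim _ ratio)//.
rewrite sigma2_ratio//; first by field.
exact: PGH.
Unshelve. all: by end_near. Qed.
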